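(* For any epoch schedule $0=\tau_0<\tau_1<\tau_2<\cdots$ (with $\tau_{m+1}\le2\tau_m$ for $m\ge1$ and $\tau_1=O(1)$) and any $M\in\mathbb N$ sufficiently large, there exist a distribution $\mathcal D$ over $X\times[0,1]^A$ and a policy class $\Pi\subseteq A^X$ such that, with probability at least $1-\delta$, $$\inf_{m\in\mathbb N:\ \tau_m\ge\tau_M/2}\ \inf_{Q\in\mathcal Q_m}|\mathrm{supp}(Q)|=\Omega\left(\sqrt{\frac{K\tau_M}{\ln(|\Pi|\tau_M/\delta)}}\right),$$ where $\mathcal Q_m$ is the set of all $Q\in\Delta^\Pi$ that satisfy the low-variance constraint in round $\tau_m$: $$\widehat{\mathbb E}_{x\sim H_{\tau_m}}\left[\frac1{Q^{\mu_m}(\pi(x)|x)}\right]\le2K+\frac{\widehat{\mathrm{Reg}}_{\tau_m}(\pi)}{\psi\mu_m}\quad\text{for all }\pi\in\Pi,\qquad\psi=100,$$ and $\mathrm{supp}(Q)\subseteq\Pi$ is the support of $Q$ (the set of policies on which $Q$ is non-zero). Here the history is the one generated by the algorithm ILOVETOCONBANDITS (defined in the context) run with this epoch schedule and $\delta$.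
   Context: Setting. $A$ is a finite set of $K$ actions, $X$ a space of contexts, $\Pi\subseteq A^X$ a finite set of policies, $\mathcal D$ a distribution over $X\times[0,1]^A$, $\delta\in(0,1)$. Pairs $(x_t,r_t)$ are i.i.d. from $\mathcal D$; in round $t$ the agent observes $x_t$, randomly chooses $a_t$ (with probability $p_t(a_t)$), and receives $r_t(a_t)$. $H_t$ is the history of records $(x_i,a_i,r_i(a_i),p_i(a_i))$, $i\le t$; $\widehat{\mathbb E}_{x\sim H_t}$ is expectation over $x$ uniform among the $t$ contexts of $H_t$. $\widehat{\mathcal R}_t(\pi)=\frac1t\sum_{i=1}^t\frac{r_i(a_i)\mathbf 1\{\pi(x_i)=a_i\}}{p_i(a_i)}$; $\pi_t\in\arg\max_{\pi\in\Pi}\widehat{\mathcal R}_t(\pi)$ ($\pi_0$ arbitrary); $\widehat{\mathrm{Reg}}_t(\pi)=\widehat{\mathcal R}_t(\pi_t)-\widehat{\mathcal R}_t(\pi)$. Weights. $\Delta^\Pi=\{Q\in\mathbb R^\Pi: Q(\pi)\ge 0\ \forall\pi,\ \sum_\pi Q(\pi)\le 1\}$. $Q(a|x)=\sum_{\pi:\pi(x)=a}Q(\pi)$ and $Q^\mu(a|x)=(1-K\mu)Q(a|x)+\mu$. (OP). Given $H_t$ and $\mu_m$, let $b_\pi=\widehat{\mathrm{Reg}}_t(\pi)/(\psi\mu_m)$ with $\psi=100$. Find $Q\in\Delta^\Pi$ with $\sum_\pi Q(\pi)b_\pi\le 2K$ and, for all $\pi\in\Pi$, $\widehat{\mathbb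 E}_{x\sim H_t}[1/Q^{\mu_m}(\pi(x)|x)]\le 2K+b_\pi$. Algorithm ILOVETOCONBANDITS. Set $\mu_0=1/(2K)$ and $\mu_m=\min\{\frac1{2K},\sqrt{\ln(16\tau_m^2|\Pi|/\delta)/(K\tau_m)}\}$ for $m\ge 1$; $Q_0=\mathbf 0$, $m=1$. In each round $t=1,2,\dots$: observe $x_t$; let $\tilde Q_{m-1}=Q_{m-1}+(1-\sum_\pi Q_{m-1}(\pi))\mathbf 1_{\pi_{\tau_{m-1}}}$, where $\mathbf 1_{\pi}$ is the unit mass on $\pi$; draw $a_t$ from $\tilde Q_{m-1}^{\mu_{m-1}}(\cdot|x_t)$ and set $p_t(a_t)=\tilde Q_{m-1}^{\mu_{m-1}}(a_t|x_t)$; observe $r_t(a_t)$; if $t=\tau_m$, let $Q_m$ be a solution of (OP) with history $H_t$ and minimum probability $\mu_m$, and set $m:=m+1$.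
   Formalization: Assumes K ≥ 2 and that X is infinite with measurable singletons: for K = 1 or finite X the supports have size at most |Π| ≤ K^|X|, which stays bounded while the claimed lower bound tends to infinity as M grows. *)

(* Defs.v *)
From HB Require Import structures.
From mathcomp Require Import all_boot all_order all_algebra finmap.
From mathcomp Require Import all_classical all_reals all_analysis.

Set Implicit Arguments.
Unset Strict Implicit.
Unset Printing Implicit Defensive.

Import Order.TTheory GRing.Theory Num.Theory.
Import numFieldNormedType.Exports.

Local Open Scope classical_set_scope.
Local Open Scope ring_scope.

(* Actions are 'I_K, a policy class is a finite set Pi of functions X -> 'I_K,
   and a weight vector Q in R^Pi is a function Pi -> R. *)

Definition psi {R : realType} : R := 100%:R.

(* One record (x_i, a_i, r_i(a_i), p_i(a_i)) of the history. *)
Record entry (R : realType) (X : Type) (K : nat) := Entry {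
  e_ctx : X; e_act : 'I_K; e_rew : R; e_prob : R }.

(* (size h)^-1 is 0 for the empty history, so that Rhat vanishes at t = 0 and
   every policy is then a maximizer. *)
Definition Rhat (R : realType) (X : Type) (K : nat)
    (h : seq (entry R X K)) (pol : X -> 'I_K) : R :=
  (size h)%:R^-1 *
  \sum_(e <- h) (e_rew e * (pol (e_ctx e) == e_act e)%:R / e_prob e).

Definition is_leader (R : realType) (X : Type) (K : nat)
    (Pi : {fset (X -> 'I_K)}) (h : seq (entry R X K)) (lead : Pi) : Prop :=
  forall p : Pi, Rhat h (val p) <= Rhat h (val lead).

Definition Reghat (R : realType) (X : Type) (K : nat)
    (Pi : {fset (X -> 'I_K)}) (h : seq (entry R X K)) (lead p : Pi) : R :=
  Rhat h (val lead) - Rhat h (val p).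

Definition weights (R : realType) (X : Type) (K : nat)
    (Pi : {fset (X -> 'I_K)}) (Q : Pi -> R) : Prop :=
  (forall p, 0 <= Q p) /\ \sum_p Q p <= 1.

Definition action_weight (R : realType) (X : Type) (K : nat)
    (Pi : {fset (X -> 'I_K)}) (Q : Pi -> R) (a : 'I_K) (x : X) : R :=
  \sum_(p : Pi | val p x == a) Q p.

Definition smoothed (R : realType) (X : Type) (K : nat)
    (Pi : {fset (X -> 'I_K)}) (mu : R) (Q : Pi -> R) (a : 'I_K) (x : X) : R :=
  (1 - K%:R * mu) * action_weight Q a x + mu.

Definition emp_ctx_mean (R : realType) (X : Type) (K : nat)
    (h : seq (entry R X K)) (f : X -> R) : R :=
  (size h)%:R^-1 * \sum_(e <- h) f (e_ctx e).

Definition low_variance (R : realType) (X : Type) (K : nat)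
    (Pi : {fset (X -> 'I_K)}) (h : seq (entry R X K)) (lead : Pi) (mu : R)
    (Q : Pi -> R) : Prop :=
  forall p : Pi,
    emp_ctx_mean h (fun x => (smoothed mu Q (val p x) x)^-1)
      <= 2%:R * K%:R + Reghat h lead p / (psi * mu).

Definition low_variance_weights (R : realType) (X : Type) (K : nat)
    (Pi : {fset (X -> 'I_K)}) (h : seq (entry R X K)) (lead : Pi) (mu : R)
    : set (Pi -> R) :=
  [set Q | weights Q /\ low_variance h lead mu Q].

Definition OP_solution (R : realType) (X : Type) (K : nat)
    (Pi : {fset (X -> 'I_K)}) (h : seq (entry R X K)) (lead : Pi) (mu : R)
    (Q : Pi -> R) : Prop :=
  [/\ weights Q,
      \sum_p Q p * (Reghat h lead p / (psi * mu)) <= 2%:R * K%:R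
    & low_variance h lead mu Q].

Definition supp_card (R : realType) (X : Type) (K : nat)
    (Pi : {fset (X -> 'I_K)}) (Q : Pi -> R) : nat :=
  #|[pred p : Pi | Q p != 0]|.

Definition epoch_schedule (tau : nat -> nat) : Prop :=
  [/\ tau 0%N = 0%N,
      forall m, (tau m < tau m.+1)%N
    & forall m, (1 <= m)%N -> (tau m.+1 <= 2 * tau m)%N].

Definition min_prob (R : realType) (K N : nat) (delta : R) (tau : nat -> nat)
    (m : nat) : R :=
  if m == 0%N then (2%:R * K%:R)^-1
  else Num.min (2%:R * K%:R)^-1
         (Num.sqrt (ln (16%:R * (tau m)%:R ^+ 2 * N%:R / delta)
                    / (K%:R * (tau m)%:R))).

(* Qtilde: the missing mass of Q is put on lead. *)
Definition completed (R : realType) (X : Type) (K : nat)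
    (Pi : {fset (X -> 'I_K)}) (Q : Pi -> R) (lead : Pi) : Pi -> R :=
  fun p => Q p + (1 - \sum_q Q q) * (p == lead)%:R.

(* The processes of a run, on a sample space Om; rounds are numbered from 1
   (the value at 0 of ctx, rew, act and dist is irrelevant).
   lead t is pi_t, wt m is Q_m, and dist t w is the distribution on actions
   from which a_t is drawn. *)
Record processes (R : realType) (X : Type) (K : nat)
    (Pi : {fset (X -> 'I_K)}) (Om : Type) := Processes {
  ctx : nat -> Om -> X;
  rew : nat -> Om -> K.-tuple R;
  act : nat -> Om -> 'I_K;
  dist : nat -> Om -> 'I_K -> R;
  lead : nat -> Om -> Pi;
  wt : nat -> Om -> Pi -> R }.

Definition history (R : realType) (X : Type) (K : nat)
    (Pi : {fset (X -> 'I_K)}) (Om : Type) (Z : processes R Pi Om)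
    (t : nat) (w : Om) : seq (entry R X K) :=
  [seq Entry (ctx Z i w) (act Z i w) (tnth (rew Z i w) (act Z i w))
             (dist Z i w (act Z i w)) | i <- iota 1 t].

(* Z is a run of ILOVETOCONBANDITS on the probability space (Om, P).
   F t is the information available at the end of round t: any filtration to
   which the processes are adapted, so that ties in pi_t and the choice of the
   solution Q_m may be resolved arbitrarily, possibly with extra randomness.
   - run_fresh: (x_{t+1}, r_{t+1}) has law D and is independent of F t; together
     with adaptedness this makes the pairs i.i.d. with law D.
   - run_draw: conditionally on F t and (x_{t+1}, r_{t+1}), the action a_{t+1}
     equals a with probability dist_{t+1}(a); the conditional probability is
     characterized by its integrals over the sets E `&` (x,r)_{t+1} @^-1` B,
     which form a pi-system generating the conditioning sigma-algebra.
   - run_dist: round t lies in epoch m.+1 when tau m < t <= tau m.+1. *)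
Record ilovetoconbandits_run (R : realType) (d : measure_display)
    (X : measurableType d) (K : nat) (tau : nat -> nat) (delta : R)
    (D : probability (X * K.-tuple R)%type R) (Pi : {fset (X -> 'I_K)})
    (d' : measure_display) (Om : measurableType d') (P : probability Om R)
    (F : nat -> set (set Om)) (Z : processes R Pi Om) : Prop := {
  run_sigma : forall t, sigma_algebra setT (F t);
  run_sub : forall t, F t `<=` measurable;
  run_incr : forall t, F t `<=` F t.+1;
  run_ctx_meas : forall t (B : set X), measurable B ->
    F t.+1 (ctx Z t.+1 @^-1` B);
  run_rew_meas : forall t (B : set (K.-tuple R)), measurable B ->
    F t.+1 (rew Z t.+1 @^-1` B);
  run_act_meas : forall t (a : 'I_K), F t.+1 (act Z t.+1 @^-1` [set a]);
  run_lead_meas : forall t (p : Pi), F t (lead Z t @^-1` [set p]);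
  run_wt_meas : forall m (p : Pi) (B : set R), measurable B ->
    F (tau m) ((fun w => wt Z m w p) @^-1` B);
  run_fresh : forall t (E : set Om) (B : set (X * K.-tuple R)),
    F t E -> measurable B ->
    (P (E `&` (fun w => (ctx Z t.+1 w, rew Z t.+1 w)) @^-1` B) = P E * D B)%E;
  run_draw : forall t (E : set Om) (B : set (X * K.-tuple R)) (a : 'I_K),
    F t E -> measurable B ->
    let C := E `&` (fun w => (ctx Z t.+1 w, rew Z t.+1 w)) @^-1` B in
    P (C `&` act Z t.+1 @^-1` [set a])
      = (\int[P]_(w in C) (dist Z t.+1 w a)%:E)%E;
  run_dist : forall m t w a, (tau m < t <= tau m.+1)%N ->
    dist Z t w a =
      smoothed (min_prob K #|` Pi| delta tau m)
        (completed (wt Z m w) (lead Z (tau m) w)) a (ctx Z t w);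
  run_lead : forall t w, is_leader (history Z t w) (lead Z t w);
  run_wt0 : forall w p, wt Z 0%N w p = 0;
  run_wt : forall m w, (1 <= m)%N ->
    OP_solution (history Z (tau m) w) (lead Z (tau m) w)
      (min_prob K #|` Pi| delta tau m) (wt Z m w) }.

(* "With probability at least q" for an event not assumed measurable. *)
Definition with_prob_ge (R : realType) (d : measure_display)
    (Om : measurableType d) (P : probability Om R) (q : R) (S : set Om) : Prop :=
  exists E : set Om, [/\ measurable E, E `<=` S & (q%:E <= P E)%E].

(* Main.v *)
(* All rewards are 0, so every policy has estimated regret 0 and the low-variance
   constraint bounds each mean of 1/Q^mu(pi(x)|x) by 2K, whatever the algorithm
   does. The contexts are uniform on N points x_i with N of order
   sqrt(tau_M / (K ln(tau_M/delta))), and Pi consists of the N(K-1) policies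
   that play a fixed action except at a single x_i. Each of them is alone in
   playing its deviating action at x_i; if it had weight 0, the visits to x_i
   alone would contribute (frequency of x_i)/mu_m > 2K. Hence Q charges all of
   Pi as soon as every x_i has frequency at least 1/(8N). A Chernoff bound at
   the times 2^k ceil(tau_M/2) gives this for all t >= tau_M/2 at once, the
   counts being monotone in t. *)
Require Import Defs.
From HB Require Import structures.
From mathcomp Require Import all_boot all_order all_algebra finmap.
From mathcomp Require Import all_classical all_reals all_analysis.
From mathcomp Require Import ring lra.

Set Implicit Arguments.
Unset Strict Implicit.
Unset Printing Implicit Defensive.

Import Order.TTheory GRing.Theory Num.Theory.
Import numFieldNormedType.Exports.

Local Open Scope classical_set_scope.
Local Open Scope ring_scope.

(** * Visit counts and their lower tail *)

Definition hits (T : Type) (A : nat -> set T) (t : nat) (w : T) : nat :=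
  count (fun s => `[< A s w >]) (iota 1 t).

Lemma hitsS (T : Type) (A : nat -> set T) (t : nat) (w : T) :
  hits A t.+1 w = (hits A t w + `[< A t.+1 w >])%N.
Proof. by rewrite /hits -(addn1 t) iotaD count_cat /= addn0 add1n addn1. Qed.

Lemma hits_leS (T : Type) (A : nat -> set T) (t k : nat) :
  [set w | hits A t.+1 w <= k.+1]%N =
  ([set w | hits A t w <= k.+1]%N `\` A t.+1) `|`
  ([set w | hits A t w <= k]%N `&` A t.+1).
Proof.
apply/seteqP; split => w /=; rewrite hitsS; case: asboolP => Aw;
  rewrite ?addn0 ?addn1 ?ltnS.
- by right.
- by left.
- by move=> [[]|[]].
- by move=> [[]|[]].
Qed.

Lemma hits_le0 (T : Type) (A : nat -> set T) (t : nat) :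
  [set w | hits A t.+1 w <= 0]%N = [set w | hits A t w <= 0]%N `\` A t.+1.
Proof.
apply/seteqP; split => w /=; rewrite hitsS; case: asboolP => Aw;
  by rewrite ?addn0 ?addn1 //; case.
Qed.

Lemma leq_hits (T : Type) (A : nat -> set T) (t t' : nat) (w : T) :
  (t <= t')%N -> (hits A t w <= hits A t' w)%N.
Proof.
move=> /subnKC <-; elim: (t' - t)%N => [|n IH]; first by rewrite addn0.
by rewrite addnS hitsS (leq_trans IH)// leq_addr.
Qed.

Section LowerTail.
Context (R : realType) (d : measure_display) (T : measurableType d)
  (P : probability T R) (F : nat -> set (set T)) (A : nat -> set T) (p : R).
Hypothesis Fsigma : forall t, sigma_algebra setT (F t).
Hypothesis Fsub : forall t, F t `<=` measurable.
Hypothesis Fincr : forall t, F t `<=` F t.+1.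
Hypothesis FA : forall t, F t.+1 (A t.+1).
Hypothesis p01 : 0 <= p <= 1.
Hypothesis indep : forall t E, F t E -> P (E `&` A t.+1) = (P E * p%:E)%E.

Lemma hits_le_adapted (t k : nat) : F t [set w | hits A t w <= k]%N.
Proof.
(* Since [F u] equals the sigma-algebra it generates, [g_sigma_algebraType (F u)] makes the closure
   properties of measurable sets available for it. *)
have FU u B C : F u B -> F u C -> F u (B `|` C).
  move=> FB FC; rewrite -(sigma_algebra_id (Fsigma u)) in FB FC *.
  exact: (@measurableU _ (g_sigma_algebraType (F u))).
have FD u B C : F u B -> F u C -> F u (B `\` C).
  move=> FB FC; rewrite -(sigma_algebra_id (Fsigma u)) in FB FC *.
  exact: (@measurableD _ (g_sigma_algebraType (F u))).
have FI u B C : F u B -> F u C -> F u (B `&` C).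
  move=> FB FC; rewrite -(sigma_algebra_id (Fsigma u)) in FB FC *.
  exact: (@measurableI _ (g_sigma_algebraType (F u))).
elim: t k => [|t IH] k.
  have -> : [set w | hits A 0 w <= k]%N = setT by apply/seteqP.
  rewrite -(sigma_algebra_id (Fsigma 0%N)).
  exact: (@measurableT _ (g_sigma_algebraType (F 0%N))).
case: k => [|k]; first by rewrite hits_le0; apply: FD => //; apply: Fincr.
by rewrite hits_leS; apply: FU; [apply: FD|apply: FI] => //; apply: Fincr.
Qed.

(** This is Markov's inequality for 2 to the power minus [hits]: each round multiplies the
    expectation by (1 - p) + p/2 = 1 - p/2. The induction on [t] carries this out on probabilities
    alone, splitting by whether round [t.+1] is a hit. *)
Lemma hits_lower_tail (t k : nat) :
  (P [set w | (hits A t w <= k)%N] <= (2 ^+ k * (1 - p / 2) ^+ t)%:E)%E.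
Proof.
have [p0 p1] := andP p01.
have q0 : 0 <= 1 - p / 2 by lra.
have mA u : measurable (A u.+1) by exact: (Fsub (FA u)).
have mH u j : measurable [set w | hits A u w <= j]%N.
  exact: (Fsub (hits_le_adapted u j)).
have PD u j : P ([set w | hits A u w <= j]%N `\` A u.+1) =
    (fine (P [set w | hits A u w <= j]%N) * (1 - p))%:E.
  have -> : P ([set w | hits A u w <= j]%N `\` A u.+1) =
      (P [set w | hits A u w <= j]%N -
       P ([set w | hits A u w <= j]%N `&` A u.+1))%E.
    by apply: measureD => //; rewrite -ge0_fin_numE ?fin_num_measure.
  rewrite indep; last exact: hits_le_adapted.
  by rewrite -(@fineK _ (P _)) ?fin_num_measure// -EFinM -EFinB mulrBr mulr1.
have PH u j : P [set w | hits A u w <= j]%N =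
    (fine (P [set w | hits A u w <= j]%N))%:E.
  by rewrite fineK ?fin_num_measure.
elim: t k => [|t IH] k.
  have -> : [set w | hits A 0 w <= k]%N = setT by apply/seteqP.
  by rewrite probability_setT expr0 mulr1 lee_fin exprn_ege1// ler1n.
have f0 u j : 0 <= fine (P [set w | hits A u w <= j]%N) by rewrite fine_ge0.
have IHf j : fine (P [set w | hits A t w <= j]%N) <= 2 ^+ j * (1 - p / 2) ^+ t.
  by rewrite -lee_fin -PH; exact: IH.
case: k => [|k].
  rewrite hits_le0 PD lee_fin exprSr mulrA.
  by apply: ler_pM => //; lra.
have PU : P [set w | hits A t.+1 w <= k.+1]%N =
    (P ([set w | hits A t w <= k.+1]%N `\` A t.+1) +
     P ([set w | hits A t w <= k]%N `&` A t.+1))%E.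
  rewrite hits_leS; apply: measureU; first exact: measurableD.
    exact: measurableI.
  by rewrite -subset0 => w [[_ nA] [_ /nA]].
rewrite PU indep; last exact: hits_le_adapted.
rewrite PD (PH t k) -EFinM -EFinD lee_fin.
(* With q = 1 - p/2, a miss keeps the level [k.+1] and a hit lowers it to [k], so the two terms add
   up to 2^(k+1) q^t (1 - p + p/2), exactly the required bound. *)
apply: (@le_trans _ _ (2 ^+ k.+1 * (1 - p / 2) ^+ t * (1 - p) +
    2 ^+ k * (1 - p / 2) ^+ t * p)).
  by apply: lerD; apply: ler_wpM2r => //; lra.
have alg (a b : R) :
    2 * a * b * (1 - p) + a * b * p <= 2 * a * ((1 - p / 2) * b).
  by lra.
by rewrite (exprS 2 k) (exprS (1 - p / 2) t); exact: alg.
Qed.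

(** A threshold of at most a quarter of the mean tp gives 2^k <= e^k <= e^(tp/4), while (1 - p/2)^t
    <= e^(-tp/2); half of the exponent survives. *)
Lemma hits_lower_tail_expR (t k : nat) : k%:R <= t%:R * p / 4 ->
  (P [set w | (hits A t w <= k)%N] <= (expR (- (t%:R * p / 4)))%:E)%E.
Proof.
move=> hk; apply: (le_trans (hits_lower_tail t k)); rewrite lee_fin.
have [p0 p1] := andP p01.
have e2 : 2 <= expR 1 :> R by have := expR_ge1Dx (1 : R); lra.
have h : 1 - p / 2 <= expR (- (p / 2)) by exact: expR_ge1Dx.
have q0 : 0 <= 1 - p / 2 by lra.
apply: (@le_trans _ _ (expR 1 ^+ k * expR (- (p / 2)) ^+ t)).
  apply: ler_pM.
  - by apply: exprn_ge0.
  - by apply: exprn_ge0.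
  - by apply: lerXn2r => //; rewrite nnegrE ?expR_ge0.
  - by apply: lerXn2r => //; rewrite nnegrE ?expR_ge0.
rewrite -(expRM_natl k) -(expRM_natl t) -expRD ler_expR; lra.
Qed.

End LowerTail.

(** * The uniform law on finitely many points *)

Definition uniform_seq {R : realType} {d : measure_display} {T : measurableType d}
    (x : nat -> T) (n : nat) : set T -> \bar R :=
  mscale (n.+1%:R^-1)%:nng (msum (fun i => \d_(x i)) n.+1).

HB.instance Definition _ (R : realType) (d : measure_display)
    (T : measurableType d) (x : nat -> T) (n : nat) :=
  Measure.on (@uniform_seq R d T x n).

Lemma uniform_seqE (R : realType) (d : measure_display) (T : measurableType d)
    (x : nat -> T) (n : nat) (B : set T) :
  @uniform_seq R d T x n B =
    (n.+1%:R^-1 * (\sum_(i < n.+1) `[< B (x i) >])%:R)%:E.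
Proof.
by rewrite /uniform_seq /mscale /= /msum EFinM natr_sum -sumEFin.
Qed.

Lemma uniform_seq_full (R : realType) (d : measure_display) (T : measurableType d)
    (x : nat -> T) (n : nat) (B : set T) :
  (forall i, B (x i)) -> @uniform_seq R d T x n B = 1%E.
Proof.
move=> Bx; rewrite uniform_seqE; under eq_bigr => i _ do rewrite asboolT//.
by rewrite sum1_card card_ord mulVf// pnatr_eq0.
Qed.

HB.instance Definition _ (R : realType) (d : measure_display)
    (T : measurableType d) (x : nat -> T) (n : nat) :=
  Measure_isProbability.Build d T R (@uniform_seq R d T x n)
    (@uniform_seq_full R d T x n setT (fun=> Logic.I)).

Lemma uniform_seq_atom (R : realType) (d : measure_display) (T : measurableType d)
    (x : nat -> T) (n : nat) (B : set T) (i : 'I_n.+1) :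
  (forall j : 'I_n.+1, B (x j) <-> j = i) ->
  @uniform_seq R d T x n B = (n.+1%:R^-1)%:E.
Proof.
move=> Bx; rewrite uniform_seqE (bigD1 i)//= asboolT; last exact/Bx.
rewrite big1 ?addn0 ?mulr1// => j ji.
by rewrite asboolF// => /Bx /eqP; apply/negP.
Qed.

(** * Policies forced into the support, and the policy class *)

Lemma count_le_sum (R : realType) (X : Type) (K : nat) (h : seq (entry R X K))
    (f : X -> R) (x : X) : (forall y, 0 <= f y) ->
  (count (fun e => `[< e_ctx e = x >]) h)%:R * f x <= \sum_(e <- h) f (e_ctx e).
Proof.
move=> f0; elim: h => [|e h IH] /=; first by rewrite big_nil mul0r.
rewrite big_cons natrD mulrDl; apply: lerD => //.
by case: asboolP => [->|_]; rewrite ?mul1r ?mul0r.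
Qed.

(* A policy outside the support that is alone in playing [a] at [x] gives
   [smoothed mu Q a x = mu], hence a summand [1 / mu] for every visit of [x]. *)
Lemma low_variance_full_support (R : realType) (X : Type) (K : nat)
    (Pi : {fset (X -> 'I_K)}) (h : seq (entry R X K)) (lead : Pi) (mu : R)
    (Q : Pi -> R) :
  0 < mu -> K%:R * mu <= 1 ->
  (forall p : Pi, Rhat h (val p) = 0) ->
  (forall p : Pi, exists x : X,
    (forall q : Pi, val q x = val p x -> q = p) /\
    2 * K%:R * mu * (size h)%:R
      < (count (fun e => `[< e_ctx e = x >]) h)%:R) ->
  low_variance_weights h lead mu Q -> supp_card Q = #|` Pi|.
Proof.
move=> mu0 Kmu R0 sep [[Q0 _] lv].
rewrite /supp_card cardfE; apply/eq_card => p; rewrite !inE.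
apply/eqP => Qp; have [x [uniq_p cnt]] := sep p.
have := lv p; rewrite /Reghat !R0 subrr mul0r addr0 /emp_ctx_mean.
have sm0 q y : 0 <= smoothed mu Q (val q y) y.
  rewrite /smoothed addr_ge0 ?(ltW mu0)// mulr_ge0 ?subr_ge0//.
  by apply: sumr_ge0.
have smx : smoothed mu Q (val p x) x = mu.
  rewrite /smoothed /action_weight big1 ?mulr0 ?add0r// => q /eqP /uniq_p ->.
  exact: Qp.
(* The strict inequality in [cnt] rules out the empty history. *)
have sz : 0 < (size h)%:R :> R.
  rewrite ltr0n lt0n; apply: contraTneq cnt => /size0nil ->.
  by rewrite /= mulr0 ltxx.
rewrite mulrC ler_pdivrMr// => ub.
have inv_sm0 y : 0 <= (smoothed mu Q (val p y) y)^-1 by rewrite invr_ge0.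
have := count_le_sum h x inv_sm0; rewrite smx => /le_trans/(_ ub).
by rewrite ler_pdivrMr// leNgt mulrAC cnt.
Qed.

(** The default action is [ord0], and [lift ord0 j] runs through the [K.+1] other actions, so that a
    deviation differs from the default by construction. *)
Definition spike (X : Type) (K : nat) (x : X) (j : 'I_K.+1) : X -> 'I_K.+2 :=
  fun y => if `[< y = x >] then lift ord0 j else ord0.

Lemma spikexx (X : Type) (K : nat) (x : X) (j : 'I_K.+1) :
  spike x j x = lift ord0 j.
Proof. by rewrite /spike asboolT. Qed.

(** At its own point a spike plays a non-default action, which another spike can match only by
    sitting at the same point with the same deviation. This yields both the uniqueness needed for
    full support and the size of the class. *)
Lemma eq_spike_at (X : Type) (K : nat) (x y : X) (i j : 'I_K.+1) :
  spike y i x = spike x j x -> y = x /\ i = j.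
Proof. by rewrite spikexx /spike; case: asboolP => // -> /lift_inj. Qed.

Lemma measurable_spike (d : measure_display) (X : measurableType d) (K : nat)
    (x : X) (j : 'I_K.+1) (a : 'I_K.+2) :
  measurable [set x] -> measurable (spike x j @^-1` [set a]).
Proof.
move=> mx.
have -> : spike x j @^-1` [set a] =
  (if lift ord0 j == a then [set x] else set0) `|`
  (if ord0 == a then ~` [set x] else set0).
  apply/seteqP; split => y; rewrite /spike /=.
    by case: asboolP => yx <-; rewrite eqxx; [left|right].
  by case: asboolP => yx [|]; case: eqP.
by apply: measurableU; case: ifP => // _; exact: measurableC.
Qed.

(** * Numerical estimates on the logarithm, [min_prob] and the number of contexts *)

Lemma ln_leB1 (R : realType) (x : R) : 0 < x -> ln x <= x - 1.
Proof.
by move=> x0; rewrite -ler_expR lnK ?posrE//; have := expR_ge1Dx (x - 1); lra.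
Qed.

Lemma log_scale_large (R : realType) (K : nat) (C delta : R) :
  0 < C -> 0 < delta -> exists M0 : nat, forall n : nat, (M0 <= n)%N ->
  [/\ (16 <= n)%N, (K <= n)%N, delta^-1 <= ln (n%:R / delta)
    & C * ln (n%:R / delta) <= n%:R].
Proof.
(* The tangent to the logarithm at [a] bounds C ln(n/delta) by C ln a + n/2; the other half of [n]
   absorbs C ln a. The four summands of the witness serve the four conclusions in order. *)
move=> C0 d0; set a : R := 2 * C / delta.
have a0 : 0 < a by rewrite divr_gt0// mulr_gt0.
exists (16 + K + (Num.truncn (delta * expR delta^-1)).+1
  + (Num.truncn (2 * C * ln a)).+1)%N => n hn.
have n0 : (0 < n)%N by rewrite (leq_trans _ hn).
have nd0 : 0 < n%:R / delta by rewrite divr_gt0// ltr0n.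
split.
- by rewrite (leq_trans _ hn)// -!addnA leq_addr.
- by rewrite (leq_trans _ hn)// -!addnA addnCA leq_addr.
- rewrite -ler_expR lnK ?posrE// ler_pdivlMr// mulrC.
  rewrite (le_trans (ltW (truncnS_gt _)))// ler_nat (leq_trans _ hn)//.
  by rewrite addnAC leq_addl.
- have large : 2 * C * ln a <= n%:R.
    rewrite (le_trans (ltW (truncnS_gt _)))// ler_nat (leq_trans _ hn)//.
    exact: leq_addl.
  have tangent : ln (n%:R / delta / a) <= n%:R / delta / a - 1.
    by apply: ln_leB1; rewrite divr_gt0.
  rewrite ln_div ?posrE// in tangent.
  have scaled : n%:R / delta / a = n%:R / (2 * C).
    by rewrite /a; field; rewrite !gt_eqF.
  rewrite scaled in tangent.
  have : C * ln (n%:R / delta) <= C * (ln a + n%:R / (2 * C)).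
    by apply: ler_wpM2l; lra.
  have -> : C * (ln a + n%:R / (2 * C)) = 2 * C * ln a / 2 + n%:R / 2.
    by field; rewrite gt_eqF.
  lra.
Qed.

(** [T] stands for tau_M, while tau_m may be far larger than T/2. The ratio s = 2 tau_m / T enters
    the logarithm in [min_prob] only through 2 ln s <= 2(s - 1), which the division by tau_m
    outweighs, so one bound in terms of [T] covers all late epochs. *)
Lemma min_prob_bounds (R : realType) (K N : nat) (delta : R) (tau : nat -> nat)
    (m : nat) (T : nat) :
  (0 < m)%N -> (0 < K)%N -> (0 < N)%N -> 0 < delta < 1 ->
  (16 <= T)%N -> (K <= T)%N -> (N <= K * T)%N -> 1 <= ln (T%:R / delta) ->
  T%:R / 2 <= (tau m)%:R :> R ->
  [/\ 0 < min_prob K N delta tau m, K%:R * min_prob K N delta tau m <= 1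
    & min_prob K N delta tau m <= 4 / Num.sqrt (K%:R * T%:R / ln (T%:R / delta))].
Proof.
move=> m0 K0 N0 /andP[d0 d1] T16 KT NKT l1 hm.
set l := ln (T%:R / delta) in l1 *.
rewrite /min_prob gtn_eqF//.
have k1 : 1 <= K%:R :> R by rewrite ler1n.
have n1 : 1 <= N%:R :> R by rewrite ler1n.
have t16 : 16 <= T%:R :> R by rewrite (ler_nat R 16).
have kt : K%:R <= T%:R :> R by rewrite ler_nat.
have nkt : N%:R <= K%:R * T%:R :> R by rewrite -natrM ler_nat.
set t : R := (tau m)%:R in hm *.
set s : R := 2 * t / T%:R.
have s1 : 1 <= s by rewrite /s ler_pdivlMr; lra.
have d1i : 1 <= delta^-1 by rewrite invf_ge1// ltW.
set A := 16%:R * t ^+ 2 * N%:R / delta.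
have A1 : 1 < A.
  have t2 : 1 <= t ^+ 2 by apply: exprn_ege1; lra.
  rewrite /A ltr_pdivlMr// mul1r; nra.
have lnA0 : 0 < ln A by rewrite ln_gt0.
have u0 : 0 < ln A / (K%:R * t) by rewrite divr_gt0// mulr_gt0//; lra.
have bnd : ln A / (K%:R * t) <= 16 * (l / (K%:R * T%:R)).
  (* The factor 4 T^2 N / delta left after extracting s^2 is at most (T/delta)^5, because N <= K T
     <= T^2, 4 <= T and delta < 1. *)
  have lA : ln A <= 2 * ln s + 5 * l.
    have x0 : 0 < T%:R / delta by rewrite divr_gt0//; lra.
    have -> : 2 * ln s + 5 * l = ln (s ^+ 2 * (T%:R / delta) ^+ 5).
      rewrite lnM ?posrE ?exprn_gt0//; last by lra.
      by rewrite !lnXn ?[s]posrE//; [rewrite -!(mulr_natl (ln _))|lra..].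
    rewrite ler_ln ?posrE; [|lra|by rewrite mulr_gt0 ?exprn_gt0//; lra].
    have -> : A = s ^+ 2 * (4 * T%:R ^+ 2 * N%:R / delta).
      by rewrite /A /s; field; rewrite !gt_eqF//; lra.
    apply: ler_wpM2l; first by rewrite exprn_ge0//; lra.
    have -> : (T%:R / delta) ^+ 5 =
        T%:R ^+ 2 * (T%:R ^+ 2 * T%:R) * (delta^-1 ^+ 4) / delta.
      by field; rewrite gt_eqF.
    apply: ler_wpM2r; first by rewrite invr_ge0 ltW.
    apply: (@le_trans _ _ (T%:R ^+ 2 * (T%:R ^+ 2 * T%:R))); last first.
      rewrite ler_peMr ?exprn_ege1// !mulr_ge0 ?exprn_ge0//; lra.
    rewrite [4 * _]mulrC -mulrA; apply: ler_wpM2l; first by rewrite exprn_ge0//; lra.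
    nra.
  have ls : ln s <= s - 1 by apply: ln_leB1; lra.
  have lA2 : ln A <= 5 * l * s by nra.
  have -> : 16 * (l / (K%:R * T%:R)) = 8 * l * s / (K%:R * t).
    by rewrite /s; field; rewrite !gt_eqF//; lra.
  apply: ler_wpM2r; first by rewrite invr_ge0 mulr_ge0//; lra.
  nra.
split.
- by rewrite lt_min invr_gt0 sqrtr_gt0 u0 andbT mulr_gt0//; lra.
- rewrite (@le_trans _ _ (K%:R * (2 * K%:R)^-1))//.
    by apply: ler_wpM2l; [lra|rewrite ge_min lexx].
  have -> : K%:R * (2 * K%:R)^-1 = 2^-1 :> R by field; rewrite gt_eqF//; lra.
  by rewrite invf_le1// ler1n.
- rewrite ge_min; apply/orP; right.
  have -> : 4 / Num.sqrt (K%:R * T%:R / l) = Num.sqrt (16 * (l / (K%:R * T%:R))).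
    have -> : 16 = 4 ^+ 2 :> R by rewrite expr2; lra.
    rewrite [in RHS]sqrtrM ?sqr_ge0// sqrtr_sqr ger0_norm//; congr (_ * _).
    by rewrite -sqrtrV ?invf_div// divr_ge0 ?mulr_ge0//; lra.
  by rewrite ler_sqrt// mulr_ge0// divr_ge0 ?mulr_ge0//; lra.
Qed.

(** The number [n.+1] of contexts is the integer part of y/(64K). The factor 64 makes 2K(4/y) at
    most 1/(8 [n.+1]), the visit frequency that is guaranteed later; the last conclusion is the room
    needed by the union bound. *)
Lemma context_number (R : realType) (K T : nat) (delta : R) :
  (0 < K)%N -> 0 < delta < 1 -> (16 <= T)%N ->
  delta^-1 <= ln (T%:R / delta) -> 64 ^+ 2 * K%:R * ln (T%:R / delta) <= T%:R ->
  exists n : nat,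
  let y := Num.sqrt (K%:R * T%:R / ln (T%:R / delta)) in
  [/\ 64 * K%:R * n.+1%:R <= y, y <= 128 * K%:R * n.+1%:R, (n.+1 <= T)%N
    & 8 * n.+1%:R ^+ 2 / T%:R <= delta / 2].
Proof.
move=> K0 /andP[d0 d1] T16; set l := ln _ => l1 lT; set y := Num.sqrt _.
have k1 : 1 <= K%:R :> R by rewrite ler1n.
have t16 : 16 <= T%:R :> R by rewrite (ler_nat R 16).
have dl1 : 1 <= delta * l by rewrite mulrC -ler_pdivrMr// div1r.
have l1' : 1 <= l by nra.
have y2 : y ^+ 2 * l = K%:R * T%:R.
  rewrite sqr_sqrtr; first by field; rewrite gt_eqF//; lra.
  by rewrite divr_ge0 ?mulr_ge0//; lra.
have y0 : 0 <= y by exact: sqrtr_ge0.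
have yK : 64 * K%:R <= y.
  rewrite -(@ler_pXn2r _ 2)// ?nnegrE//.
  have : 0 < l by lra.
  move=> l0; rewrite -(ler_pM2r l0) y2; nra.
have z1 : 1 <= y / (64 * K%:R) by rewrite ler_pdivlMr; lra.
have : (0 < Num.truncn (y / (64 * K%:R)))%N by rewrite truncn_gt0.
case E : Num.truncn => [//|n] _; exists n => /=.
have [lo hi] : n.+1%:R <= y / (64 * K%:R) /\ y / (64 * K%:R) < n.+2%:R.
  by rewrite -E; split; [rewrite truncn_le//; lra|rewrite E -[in X in _ < X]E truncnS_gt].
have lo' : 64 * K%:R * n.+1%:R <= y by move: lo; rewrite ler_pdivlMr; lra.
have n1 : 1 <= n.+1%:R :> R by rewrite ler1n.
have sq : (64 * K%:R * n.+1%:R) ^+ 2 * l <= K%:R * T%:R.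
  rewrite -y2 ler_pM2r; last by lra.
  by apply: lerXn2r; rewrite ?nnegrE// !mulr_ge0//; lra.
have sq' : 64 ^+ 2 * K%:R * n.+1%:R ^+ 2 * l <= T%:R.
  rewrite -(@ler_pM2l _ K%:R); last by lra.
  by apply: le_trans sq; rewrite le_eqVlt; apply/orP; left; apply/eqP; lra.
have sq2 : 64 ^+ 2 * n.+1%:R ^+ 2 * l <= T%:R :> R.
  apply: le_trans sq'.
  apply: ler_wpM2r; first by lra.
  apply: ler_wpM2r; first by rewrite exprn_ge0.
  by lra.
have sq0 : 1 <= n.+1%:R ^+ 2 :> R by rewrite exprn_ege1.
split=> //.
- move: hi; rewrite ltr_pdivrMr; last by lra.
  rewrite -[n.+2%:R]natr1 => hi.
  have : 64 * K%:R * 1 <= 64 * K%:R * n.+1%:R :> R by apply: ler_wpM2l => //; lra.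
  lra.
- rewrite -(ler_nat R); apply: le_trans sq2.
  set b := n.+1%:R in n1 sq0 *.
  have : b <= b ^+ 2 by rewrite expr2; nra.
  nra.
(* Here delta * l >= 1 trades the factor [l] in [sq2] for a factor delta. *)
- rewrite ler_pdivrMr; last by lra.
  set b := n.+1%:R ^+ 2 in sq0 sq2 *.
  have : delta * (64 ^+ 2 * b * l) <= delta * T%:R by rewrite ler_pM2l.
  have : b <= b * (delta * l) by rewrite ler_peMr//; lra.
  have -> : delta * (64 ^+ 2 * b * l) = 64 ^+ 2 * (b * (delta * l)) by ring.
  lra.
Qed.

(** * The event that all rewards vanish and all contexts are visited often *)

Lemma measurable_preimageT (d d' : measure_display) (T : measurableType d)
    (U : measurableType d') (f : T -> U) (Y : set U) :
  measurable_fun setT f -> measurable Y -> measurable (f @^-1` Y).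
Proof. by move=> mf mY; rewrite -[X in measurable X]setTI; exact: mf. Qed.

(** This weak form of the exponential bound suffices: the mean counts double from one checkpoint to
    the next, so their reciprocals already form a geometric series. *)
Lemma expRN_le_inv (R : realType) (x : R) : 0 < x -> expR (- x) <= x^-1.
Proof.
move=> x0; rewrite expRN lef_pV2 ?posrE ?expR_gt0//.
by have := expR_ge1Dx x; lra.
Qed.

Lemma measure_bigcup_geometric (R : realType) (d : measure_display)
    (T : measurableType d) (mu : {measure set T -> \bar R}) (B : nat -> set T)
    (eps : R) :
  0 <= eps -> (forall k, measurable (B k)) ->
  (forall k, mu (B k) <= (eps / (2 ^ k.+1)%:R)%:E)%E ->
  (mu (\bigcup_k B k) <= eps%:E)%E.
Proof.
move=> eps0 mB muB.
apply: (le_trans (generalized_Boole_inequality mu mB _)).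
  exact: bigcup_measurable.
apply: le_trans (epsilon_trick0 xpredT eps0).
by apply: lee_nneseries => k _ //; exact: muB.
Qed.

(** Counts are monotone in time, so control at the checkpoints 2^k t0 extends to every later time at
    the loss of a factor 2. *)
Lemma dyadic_floor (t0 t : nat) : (0 < t0)%N -> (t0 <= t)%N ->
  exists k, (2 ^ k * t0 <= t < 2 * (2 ^ k * t0))%N.
Proof.
move=> t0_gt0 le_t; exists (trunc_log 2 (t %/ t0)).
have /andP[lo hi] :
    (2 ^ trunc_log 2 (t %/ t0) <= t %/ t0 < 2 ^ (trunc_log 2 (t %/ t0)).+1)%N.
  by apply: trunc_log_bounds => //; rewrite divn_gt0.
by rewrite -leq_divRL// lo /= mulnA -expnS -ltn_divLR.
Qed.

Lemma run_ctx_indep (R : realType) (d : measure_display) (X : measurableType d)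
    (K : nat) (tau : nat -> nat) (delta : R)
    (D : probability (X * K.-tuple R)%type R) (Pi : {fset (X -> 'I_K)})
    (d' : measure_display) (Om : measurableType d') (P : probability Om R)
    (F : nat -> set (set Om)) (Z : processes R Pi Om) (y : X) (p : R) :
  ilovetoconbandits_run tau delta D P F Z ->
  measurable [set y] -> D [set z | z.1 = y] = p%:E ->
  forall t E, F t E -> P (E `&` ctx Z t.+1 @^-1` [set y]) = (P E * p%:E)%E.
Proof.
move=> run my Dy t E FE; rewrite -Dy -(run_fresh run FE)//.
exact: (measurable_preimageT measurable_fst my).
Qed.

Lemma run_good_event (R : realType) (d : measure_display) (X : measurableType d)
    (K : nat) (tau : nat -> nat) (delta : R)
    (D : probability (X * K.-tuple R)%type R) (Pi : {fset (X -> 'I_K)})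
    (d' : measure_display) (Om : measurableType d') (P : probability Om R)
    (F : nat -> set (set Om)) (Z : processes R Pi Om) (x : nat -> X)
    (n t0 : nat) (eps : R) :
  ilovetoconbandits_run tau delta D P F Z ->
  (forall y : X, measurable [set y]) ->
  D [set z | forall a, tnth z.2 a = 0] = 1%E ->
  (forall i : 'I_n.+1, D [set z | z.1 = x i] = (n.+1%:R^-1)%:E) ->
  (0 < t0)%N -> 0 <= eps -> 4 * n.+1%:R ^+ 2 / t0%:R <= eps / 2 ->
  exists E : set Om, [/\ measurable E, ((1 - eps)%:E <= P E)%E
    & forall w, E w -> (forall t a, tnth (rew Z t.+1 w) a = 0) /\
        forall (i : 'I_n.+1) t, (t0 <= t)%N ->
          t%:R / (8 * n.+1%:R) <
            (hits (fun s => ctx Z s @^-1` [set x i]) t w)%:R :> R].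
Proof.
move=> run mX Drew Dctx t0_gt0 eps0 neps.
set N : R := n.+1%:R in Dctx neps *.
have N1 : 1 <= N by rewrite ler1n.
pose A i s := ctx Z s @^-1` [set x i].
(* A quarter of the expected number of visits to one context by time 2^k t0; the factor 2 lost
   between checkpoints turns 1/4 into 1/8. *)
pose u k : R := (2 ^ k * t0)%:R / (4 * N).
have u_gt0 k : 0 < u k.
  by rewrite divr_gt0 ?ltr0n ?muln_gt0 ?expn_gt0//; lra.
pose few k i := [set w | hits (A i) (2 ^ k * t0) w <= Num.truncn (u k)]%N.
pose zr : set (K.-tuple R) := [set r | forall a, tnth r a = 0].
pose nzrew k := rew Z k.+1 @^-1` (~` zr).
have mzr : measurable zr.
  have -> : zr = \bigcap_(a in [set: 'I_K]) (fun r => tnth r a) @^-1` [set 0].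
    by apply/seteqP; split => r /= h a; [move=> _; exact: h|exact: (h a I)].
  apply: fin_bigcap_measurable => // a _.
  apply: measurable_preimageT; first exact: measurable_tnth.
  exact: measurable_set1.
have mzr2 : measurable [set z : X * K.-tuple R | zr z.2].
  exact: (measurable_preimageT measurable_snd mzr).
have mnz k : measurable (nzrew k).
  by apply: (run_sub run (t := k.+1)); apply: (run_rew_meas run); exact: measurableC.
have Pnz k : P (nzrew k) = 0%E.
  have -> : nzrew k = setT `&`
      (fun w => (ctx Z k.+1 w, rew Z k.+1 w)) @^-1` (~` [set z | zr z.2]).
    by rewrite setTI.
  rewrite (run_fresh run)//.
  - by rewrite probability_setC// Drew subee// mule0.
  - rewrite -(sigma_algebra_id (run_sigma run k)).
    exact: (@measurableT _ (g_sigma_algebraType (F k))).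
  - exact: measurableC.
have FA i t : F t.+1 (A i t.+1) by exact: (run_ctx_meas run).
have mfew k i : measurable (few k i).
  apply: (run_sub run (t := (2 ^ k * t0)%N)); apply: hits_le_adapted => //.
  - exact: run_sigma run.
  - exact: run_incr run.
have Pfew k (i : 'I_n.+1) : (P (few k i) <= (u k)^-1%:E)%E.
  apply: (@le_trans _ _ (expR (- u k))%:E); last first.
    by rewrite lee_fin; exact: expRN_le_inv.
  have -> : u k = (2 ^ k * t0)%:R * N^-1 / 4.
    by rewrite /u; field; rewrite gt_eqF//; lra.
  apply: (hits_lower_tail_expR (run_sigma run) (run_sub run)
    (run_incr run) (FA i) (p := N^-1)).
  - by rewrite invr_ge0 ler0n /= invf_le1//; lra.
  - by move=> s E; exact: (run_ctx_indep run).
  - have -> : (2 ^ k * t0)%:R * N^-1 / 4 = u k.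
      by rewrite /u; field; rewrite gt_eqF//; lra.
    by rewrite truncn_le// ltW.
(* The index [k] counts rounds in the first set, which is null, and checkpoints in the second; one
   union over [k] handles both. *)
pose B k := nzrew k `|` \big[setU/set0]_(i < n.+1) few k i.
have mfews k : measurable (\big[setU/set0]_(i < n.+1) few k i).
  exact: bigsetU_measurable.
have mB k : measurable (B k) by exact: measurableU.
have PB k : (P (B k) <= (eps / (2 ^ k.+1)%:R)%:E)%E.
  apply: (@le_trans _ _ (P (nzrew k) + P (\big[setU/set0]_(i < n.+1) few k i))%E).
    exact: measureU2.
  rewrite Pnz add0e.
  apply: (@le_trans _ _ (\sum_(i < n.+1) P (few k i))%E).
    exact: (Boole_inequality P).
  apply: (@le_trans _ _ (\sum_(i < n.+1) (u k)^-1%:E)%E).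
    by apply: lee_sum => i _; exact: Pfew.
  rewrite sumEFin sumr_const card_ord lee_fin -(mulr_natl (u k)^-1) -/N.
  have t1 : 0 < t0%:R :> R by rewrite ltr0n.
  have p2 : 0 < (2 ^ k)%:R :> R by rewrite ltr0n expn_gt0.
  (* The union bound over the contexts costs 4 N^2 / (t0 2^k), at most eps / 2^(k+1) by [neps]. *)
  have -> : N * (u k)^-1 = 4 * N ^+ 2 / t0%:R / (2 ^ k)%:R.
    by rewrite /u natrM; field; rewrite !gt_eqF//; lra.
  have -> : eps / (2 ^ k.+1)%:R = eps / 2 / (2 ^ k)%:R.
    by rewrite expnS natrM; field; rewrite gt_eqF.
  by apply: ler_wpM2r => //; rewrite invr_ge0 ltW.
exists (~` \bigcup_k B k); split.
- exact/measurableC/bigcup_measurable.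
- rewrite probability_setC; last exact: bigcup_measurable.
  rewrite EFinB leeB//; exact: measure_bigcup_geometric.
- move=> w /= nB; split => [t a|i t le_t].
    by apply: contrapT => ra; apply: nB; exists t => //; left => /(_ a).
  have [k /andP[lo hi]] := dyadic_floor t0_gt0 le_t.
  have : ~ few k i w.
    move=> fw; apply: nB; exists k => //; right.
    by rewrite -(bigcup_mkord n.+1 (few k)); exists i => //=.
  move=> /negP; rewrite -ltnNge => hk.
  apply: (@lt_le_trans _ _ (Num.truncn (u k)).+1%:R); last first.
    by rewrite ler_nat (leq_trans hk)//; exact: leq_hits.
  apply: le_lt_trans (truncnS_gt (u k)).
  have : t%:R <= 2 * (2 ^ k * t0)%:R :> R by rewrite -natrM ler_nat ltnW.
  rewrite /u ler_pdivrMr; last by lra.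
  have -> : (2 ^ k * t0)%:R / (4 * N) * (8 * N) = 2 * (2 ^ k * t0)%:R.
    by field; rewrite gt_eqF//; lra.
  by [].
Qed.

(** * The size of the class, the shape of histories, and the lower bound on supports *)

Lemma card_spikes (X : Type) (K n : nat) (x : nat -> X) :
  injective x ->
  #|` [fset spike (x ij.1) ij.2 | ij : 'I_n * 'I_K.+1
         in {: 'I_n * 'I_K.+1}]%fset| = (n * K.+1)%N.
Proof.
move=> xinj; rewrite card_imfset /=; last first.
  move=> [i j] [i' j'] /= e.
  have [/xinj/val_inj -> ->] // : x i = x i' /\ j = j'.
  by apply: eq_spike_at; rewrite e.
by rewrite -cardE card_prod !card_ord.
Qed.

Lemma history_count (R : realType) (X : Type) (K : nat) (Pi : {fset (X -> 'I_K)})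
    (Om : Type) (Z : processes R Pi Om) (t : nat) (w : Om) (y : X) :
  count (fun e => `[< e_ctx e = y >]) (history Z t w) =
  hits (fun s => ctx Z s @^-1` [set y]) t w.
Proof. by rewrite /history count_map. Qed.

Lemma size_history (R : realType) (X : Type) (K : nat) (Pi : {fset (X -> 'I_K)})
    (Om : Type) (Z : processes R Pi Om) (t : nat) (w : Om) :
  size (history Z t w) = t.
Proof. by rewrite size_map size_iota. Qed.

Lemma Rhat_history0 (R : realType) (X : Type) (K : nat) (Pi : {fset (X -> 'I_K)})
    (Om : Type) (Z : processes R Pi Om) (t : nat) (w : Om) (p : X -> 'I_K) :
  (forall s a, tnth (rew Z s.+1 w) a = 0) -> Rhat (history Z t w) p = 0.
Proof.
(* The rounds of a history start at 1, so the unconstrained rewards at index 0 never enter. *)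
move=> rew0; rewrite /Rhat /history big_map big1_seq ?mulr0// => -[|s] /andP[_].
  by rewrite mem_iota.
by move=> _ /=; rewrite rew0 !mul0r.
Qed.

Theorem theorem4 (R : realType) :
  exists c : R, 0 < c /\
  forall (d : measure_display) (X : measurableType d),
    infinite_set [set: X] -> (forall x : X, measurable [set x]) ->
  forall (K : nat) (delta : R) (T1 : nat),
    (2 <= K)%N -> 0 < delta < 1 ->
  exists M0 : nat,
  forall tau : nat -> nat, epoch_schedule tau -> (tau 1%N <= T1)%N ->
  forall M : nat, (M0 <= M)%N ->
  exists (D : probability (X * K.-tuple R)%type R) (Pi : {fset (X -> 'I_K)}),
    [/\ D [set z | forall a : 'I_K, 0 <= tnth z.2 a <= 1] = 1%E,
        Pi != fset0,
        forall (p : Pi) (a : 'I_K), measurable (val p @^-1` [set a])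
      & forall (d' : measure_display) (Om : measurableType d')
          (P : probability Om R) (F : nat -> set (set Om))
          (Z : processes R Pi Om),
        ilovetoconbandits_run tau delta D P F Z ->
        with_prob_ge P (1 - delta)
          [set w : Om |
            ((c * Num.sqrt (K%:R * (tau M)%:R
                            / ln (#|` Pi|%:R * (tau M)%:R / delta)))%:E
             <= ereal_inf
                  [set ereal_inf
                     [set (supp_card Q)%:R%:E
                       | Q in low_variance_weights (history Z (tau m) w)
                                (lead Z (tau m) w)
                                (min_prob K #|` Pi| delta tau m)]
                   | m in [set m : nat | ((tau M)%:R / 2%:R <= (tau m)%:R :> R)%R]])%E]].
Proof.
(* With K actions and N contexts, y <= 128 K N and K <= 2(K - 1) give y <= 256 N (K - 1), where N (K
   - 1) is the size of the class. *)
exists (16 ^+ 2)^-1; split; first by rewrite invr_gt0 exprn_gt0.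
move=> d X infX mX [|[|K]]// delta T1 _ d01.
have [d0 d1] := andP d01.
have [x xinj] : exists x : nat -> X, injective x.
  have /infiniteP/pcard_injP[x xinj] := infX.
  by exists x => i j; apply: xinj; rewrite inE.
have C0 : 0 < 64 ^+ 2 * K.+2%:R :> R by rewrite mulr_gt0// exprn_gt0.
have [M0 large] := log_scale_large K.+2 C0 d0.
exists M0 => tau [tau0 tauS _] _ M leM.
(* Strict growth gives tau_M >= M, so [M0] can be chosen before the schedule. *)
have tau_ge m : (m <= tau m)%N.
  by elim: m => // m IH; exact: leq_ltn_trans IH (tauS m).
have [T16 KT l1 lT] := large (tau M) (leq_trans leM (tau_ge M)).
set T := tau M in T16 KT l1 lT *.
have [n [yN yN2 NT neps]] := context_number (ltn0Sn K.+1) d01 T16 l1 lT.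
set y := Num.sqrt _ in yN yN2.
pose Pi : {fset (X -> 'I_K.+2)} :=
  [fset spike (x ij.1) ij.2 | ij : 'I_n.+1 * 'I_K.+1 in {: 'I_n.+1 * 'I_K.+1}]%fset.
have cardPi : #|` Pi| = (n.+1 * K.+1)%N by exact: card_spikes.
pose zero_rew : K.+2.-tuple R := [tuple of nseq K.+2 0].
exists (@uniform_seq R _ _ (fun i => (x i, zero_rew)) n), Pi.
have zero_rewE a : tnth zero_rew a = 0 by rewrite tnth_nseq.
split.
- by apply: uniform_seq_full => i a; rewrite /= zero_rewE lexx ler01.
- by rewrite -cardfs_gt0 cardPi.
- move=> [p pPi] a /=; have /imfsetP[ij _ ->] := pPi.
  exact: measurable_spike.
move=> d' Om P F Z run.
have T0 : (0 < T)%N by apply: leq_trans T16.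
(* The first checkpoint [uphalf T] is the least integer time that is at least T/2. *)
have t0_gt0 : (0 < uphalf T)%N by rewrite uphalf_gt0.
have T_le : (T <= 2 * uphalf T)%N by rewrite mul2n -leq_uphalf_double.
have t0_ge : T%:R <= 2 * (uphalf T)%:R :> R by rewrite -natrM ler_nat.
have T16R : 16 <= T%:R :> R by rewrite (ler_nat R 16).
have l1' : 1 <= ln (T%:R / delta).
  by apply: le_trans l1; rewrite invf_ge1// ltW.
have y0 : 0 < y.
  by rewrite sqrtr_gt0 divr_gt0 ?mulr_gt0 ?ltr0n//; apply: lt_le_trans l1'.
have [|i||E [mE PE good]] := run_good_event run (x := x) (n := n)
  (eps := delta) mX _ _ t0_gt0 (ltW d0).
- by apply: uniform_seq_full => i a; rewrite /= zero_rewE.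
- by apply: (@uniform_seq_atom _ _ _ _ _ _ i) => j /=; split=> [/xinj/val_inj|->].
- apply: le_trans neps; rewrite ler_pdivrMr ?ltr0n// mulrAC ler_pdivlMr; last by lra.
  set b := n.+1%:R ^+ 2; have b0 : 0 <= b by rewrite exprn_ge0.
  have : b * T%:R <= b * (2 * (uphalf T)%:R) by exact: ler_wpM2l.
  by lra.
exists E; split=> // w /good[rew0 visits]; apply: le_ereal_inf_tmp => _ [m Tm <-].
apply: le_ereal_inf_tmp => _ [Q lvQ <-]; rewrite lee_fin.
have Tm2 : (T <= 2 * tau m)%N.
  by rewrite -(ler_nat R) natrM mulrC -ler_pdivrMr.
have m0 : (0 < m)%N by case: (m) Tm2 => //; rewrite tau0 leqNgt T0.
have [mu0 Kmu muy] : [/\ 0 < min_prob K.+2 #|` Pi| delta tau m,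
  K.+2%:R * min_prob K.+2 #|` Pi| delta tau m <= 1
  & min_prob K.+2 #|` Pi| delta tau m <= 4 / y].
  apply: min_prob_bounds => //; rewrite ?cardPi//.
  by rewrite mulnC leq_mul.
have -> : supp_card Q = #|` Pi|.
  apply: low_variance_full_support lvQ => //.
    by move=> p; exact: Rhat_history0.
  move=> [p pPi] /=; have /imfsetP[[i j] _ pE] := pPi.
  exists (x i); split.
    move=> [q qPi] /=; have /imfsetP[[i' j'] _ qE] := qPi => e.
    apply: val_inj => /=.
    by move: e; rewrite pE qE /= => e; have [-> ->] := eq_spike_at e.
  rewrite history_count size_history.
  apply: le_lt_trans (visits i (tau m) _); last by rewrite leq_uphalf_double -mul2n.
  rewrite mulrC; apply: ler_wpM2l => //.
  (* The frequency 1/(8 [n.+1]) beats 2K mu_m: by [muy] and [yN], 2K mu_m <= 8K/y <= 1/(8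
     [n.+1]). *)
  apply: (@le_trans _ _ (2 * K.+2%:R * (4 / y))); first exact: ler_wpM2l.
  rewrite mulrA ler_pdivrMr// [leRHS]mulrC ler_pdivlMr ?mulr_gt0//.
  by move: yN; lra.
rewrite cardPi.
(* The root in the claim has the larger logarithm, with the factor |Pi|, and is therefore at most
   [y]. *)
have L_ge : ln (T%:R / delta) <= ln ((n.+1 * K.+1)%:R * T%:R / delta).
  have Td : 0 < T%:R / delta by rewrite divr_gt0//; lra.
  have NK1 : 1 <= (n.+1 * K.+1)%:R :> R by rewrite ler1n.
  rewrite -mulrA ler_ln ?posrE//; first by rewrite ler_peMl// ltW.
  by rewrite mulr_gt0//; apply: lt_le_trans NK1.
rewrite ler_pdivrMl//; apply: (@le_trans _ _ y).
  rewrite ler_sqrt; last by rewrite divr_ge0 ?mulr_ge0//; lra.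
  apply: ler_wpM2l; first by rewrite mulr_ge0.
  by rewrite lef_pV2 ?posrE//; lra.
apply: (le_trans yN2).
have n1 : 1 <= n.+1%:R :> R by rewrite ler1n.
have k1 : 1 <= K.+1%:R :> R by rewrite ler1n.
rewrite natrM -(natr1 K.+1); nra.
Qed.
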